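(* Let $h>0$, $a\in\mathbb{R}$, $\nu\in(0,1]$, $y:(h\mathbb{N})_a\to\mathbb{R}^n$, and let $P\in\mathbb{R}^{n\times n}$ be a constant, square, symmetric, and positive definite matrix. Then $$\tfrac12\,{}_a\Delta_{h,\ast}^{\nu}\big(y^{T}(t)Py(t)\big)\le y^{T}(t+\nu h)\,P\,({}_a\Delta_{h,\ast}^{\nu}y)(t),\qquad t\in(h\mathbb{N})_{a+(1-\nu)h}.$$
   Context: For $h>0$ and $a\in\mathbb{R}$, $(h\mathbb{N})_a=\{a,a+h,a+2h,\dots\}$, $\sigma(t)=t+h$, and $(\Delta_h y)(t)=\frac{y(t+h)-y(t)}{h}$. The $h$-factorial function is $t_h^{(\alpha)}=h^{\alpha}\frac{\Gamma(t/h+1)}{\Gamma(t/h+1-\alpha)}$, taken to be $0$ when $t/h+1-\alpha$ is a nonpositive integer and $t/h+1$ is not. For $\mu>0$ the fractional $h$-sum is $({}_a\Delta_h^{-\mu}y)(t)=\frac{h}{\Gamma(\mu)}\sum_{s=a/h}^{t/h-\mu}(t-\sigma(sh))_h^{(\mu-1)}y(sh)$ for $t\in(h\mathbb{N})_{a+\mu h}$, where $s$ runs over $a/h,a/h+1,\dots,t/h-\mu$ and $\sigma(sh)=(s+1)h$; and ${}_a\Delta_h^{0}y=y$. For $\nu\in(0,1]$ the Caputo-like fractional $h$-difference is $({}_a\Delta_{h,\ast}^{\nu}y)(t)=({}_a\Delta_h^{-(1-\nu)}(\Delta_h y))(t)$, $t\in(h\mathbb{N})_{a+(1-\nu)h}$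 (so it equals $\Delta_h y$ if $\nu=1$); it acts componentwise on vector-valued functions. The left-hand side is this operator applied to the scalar function $t\mapsto y^T(t)Py(t)$ and evaluated at $t$. *)

(* Defs.v *)
From HB Require Import structures.
From mathcomp Require Import all_boot all_order all_algebra.
From mathcomp Require Import all_classical all_reals all_analysis.

Set Implicit Arguments.
Unset Strict Implicit.
Unset Printing Implicit Defensive.

Import Order.TTheory GRing.Theory Num.Theory.
Local Open Scope classical_set_scope.
Local Open Scope ring_scope.

(* Functions on a grid (hN)_a are represented by total functions on R; only
   their values at the points of the grid are ever used. *)

Definition hgrid (R : realType) (h a : R) : set R :=
  [set t | exists k : nat, t = a + k%:R * h].

Definition sigma (R : realType) (h t : R) : R := t + h.

Definition hdiff (R : realType) (h : R) (y : R -> R) (t : R) : R :=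
  (y (t + h) - y t) / h.

(* Euler's integral, meaningful for 0 < x. *)
Definition Gamma_int (R : realType) (x : R) : R :=
  \int[@lebesgue_measure R]_(u in `]0, +oo[) (u `^ (x - 1) * expR (- u)).

(* The usual extension Gamma x = Gamma (x + m) / (x (x + 1) ... (x + m - 1)),
   where m is the least natural number such that 0 < x + m (so m = 0 and
   Gamma x = Gamma_int x when 0 < x).  At the poles 0, -1, -2, ... the product
   vanishes, so that the value is 0 (see Gamma_pole). *)
Definition Gamma (R : realType) (x : R) : R :=
  let m := Num.truncn (1 - x) in
  Gamma_int (x + m%:R) / \prod_(i < m) (x + i%:R).

Lemma Gamma_pole (R : realType) (k : nat) : Gamma (- k%:R : R) = 0.
Proof.
rewrite /Gamma opprK [1 + _]addrC natr1 natrK.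
by rewrite big_ord_recr /= addNr mulr0 invr0 mulr0.
Qed.

(* Since 0^-1 = 0, this is 0 when t / h + 1 - alpha is a nonpositive integer
   (see hfact_pole). *)
Definition hfact (R : realType) (h t alpha : R) : R :=
  h `^ alpha * (Gamma (t / h + 1) / Gamma (t / h + 1 - alpha)).

Lemma hfact_pole (R : realType) (h t alpha : R) (k : nat) :
  t / h + 1 - alpha = - k%:R -> hfact h t alpha = 0.
Proof. by rewrite /hfact => ->; rewrite Gamma_pole invr0 !mulr0. Qed.

(* The index is s = a / h + j for j = 0, ..., t / h - mu - a / h; this last
   number is a natural number exactly when t is in hgrid h (a + mu * h), and
   values at other t are irrelevant. *)
Definition hsum (R : realType) (h a mu : R) (y : R -> R) (t : R) : R :=
  if mu == 0 then y t else
  h / Gamma mu *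
  \sum_(0 <= j < (Num.truncn (t / h - mu - a / h)).+1)
    (let s := a / h + j%:R in
     hfact h (t - sigma h (s * h)) (mu - 1) * y (s * h)).

Definition caputo (R : realType) (h a nu : R) (y : R -> R) : R -> R :=
  hsum h a (1 - nu) (hdiff h y).

Definition caputo_vec (R : realType) (n : nat) (h a nu : R)
    (y : R -> 'cV[R]_n) (t : R) : 'cV[R]_n :=
  \col_i caputo h a nu (fun u => y u i 0) t.

Definition posdefmx (R : realType) (n : nat) (P : 'M[R]_n) : Prop :=
  forall x : 'cV[R]_n, x != 0 -> 0 < (x^T *m P *m x) 0 0.

(* Main.v *)
Require Import Defs.
From HB Require Import structures.
From mathcomp Require Import all_boot all_order all_algebra.
From mathcomp Require Import all_classical all_reals all_analysis.
From mathcomp Require Import measurable_realfun ring lra.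

Set Implicit Arguments.
Unset Strict Implicit.
Unset Printing Implicit Defensive.

Import Order.TTheory GRing.Theory Num.Theory.
Import numFieldNormedType.Exports.
Local Open Scope classical_set_scope.
Local Open Scope ring_scope.

(** Write [Q u = u^T P u].  Both sides of the inequality are linear in the
increments of the functions that the operator acts on: at the [k]-th point [t]
of its grid, [caputo h a nu f t] is a sum of [c j * (f x_(j+1) - f x_j)] over
[j <= k], where [x_j = a + j h], and [t + nu h] is exactly the last node
[x_(k+1)] (lemma [caputo_weights]).  With [z = y x_(k+1)], expanding
[Q (y x_j - z)] by the symmetry of [P] turns the difference of the two sides
into the sum of [c j * (q (j+1) - q j)], where [q j = Q (y x_j - z) / 2].

The sequence [q] is nonnegative because [P] is positive definite, and it
vanishes at the last node.  The weights [c] are nonnegative and nondecreasing: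
the recent past counts most.  Summation by parts ([sum_by_parts_le]) then bounds
the sum by [c k * q (k+1) = 0].

Monotonicity of the weights is the only analytic ingredient.  For [nu < 1], up
to a positive constant, [c j] is [Gamma (m + p) / Gamma (m + 1)] with
[m = k - j] and [p = 1 - nu], and the ratio of the values at [m + 1] and [m] is
[(m + p) / (m + 1) <= 1], by the functional equation
[Gamma (x + 1) = x Gamma x] of Euler's integral ([Gamma_intD1]).  That equation
is obtained by integrating by parts on compact segments of the open half-line
and exhausting the half-line by them. *)

(** * Functional equation of Euler's integral *)

Section gamma.
Variable R : realType.
Implicit Types (x a b u : R).
Local Notation mu := (@lebesgue_measure R).

Definition gamma_kernel x u : R := u `^ (x - 1) * expR (- u).

Lemma gamma_kernel_ge0 x u : 0 <= gamma_kernel x u.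
Proof. by rewrite mulr_ge0 ?powR_ge0 ?expR_ge0. Qed.

Lemma measurable_gamma_kernel x (A : set R) :
  measurable_fun A (EFin \o gamma_kernel x).
Proof.
apply/measurable_EFinP/measurable_funTS/measurable_funM.
  exact: measurable_powR.
by apply: measurableT_comp => //; exact: measurable_expR.
Qed.

Lemma derivable_segment_LRcontinuous (F : R -> R) a b : a < b ->
  {in `[a, b], forall u, derivable F u 1} -> derivable_oo_LRcontinuous F a b.
Proof.
move=> ab dF; split.
- by move=> u uab; apply: dF; apply: subset_itv_oo_cc uab.
- apply: cvg_at_right_filter; apply/differentiable_continuous/derivable1_diffP.
  by apply: dF; rewrite in_itv/= lexx ltW.
- apply: cvg_at_left_filter; apply/differentiable_continuous/derivable1_diffP.
  by apply: dF; rewrite in_itv/= lexx ltW.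
Qed.

(** The bounds stay away from [0], where [u `^ (x - 1)] is singular for
[x < 1]. *)
Lemma gamma_kernel_by_parts x a b : 0 < x -> 0 < a -> a < b ->
  (\int[mu]_(u in `[a, b]) (gamma_kernel (x + 1) u)%:E =
   (gamma_kernel (x + 1) a - gamma_kernel (x + 1) b)%:E +
   x%:E * \int[mu]_(u in `[a, b]) (gamma_kernel x u)%:E)%E.
Proof.
move=> x0 a0 ab.
have pos u : u \in `[a, b] -> 0 < u.
  by rewrite in_itv/= => /andP[au _]; exact: lt_le_trans au.
have dpow (r u : R) : u \in `[a, b] -> derivable (@powR R ^~ r) u 1.
  by move=> /pos u0; have [] := @is_derive1_powR R r u u0.
have dexp (u : R) : is_derive u 1 (fun v : R => - expR (- v)) (expR (- u)).
  by apply: is_derive_eq; rewrite /GRing.scale/= mulrN1 opprK.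
have := @integration_by_parts R (@powR R ^~ x) (fun u => - expR (- u))
  (fun u => x * u `^ (x - 1)) (fun u => expR (- u)) a b ab.
rewrite /gamma_kernel addrK => ->.
- congr (_ + _)%E; first by congr (_%:E); ring.
  under eq_integral do rewrite mulrN EFinN -mulrA EFinM.
  rewrite integral_ge0N/=; last first.
    move=> u /pos u0; rewrite -EFinM lee_fin.
    by rewrite mulr_ge0 ?(ltW x0)// mulr_ge0 ?powR_ge0 ?expR_ge0.
  rewrite oppeK ge0_integralZl_EFin ?(ltW x0)//.
  - by move=> u _; rewrite lee_fin gamma_kernel_ge0.
  - exact: measurable_gamma_kernel.
- apply: derivable_within_continuous => u uab.
  by apply: derivableM => //; exact: dpow.
- by apply: derivable_segment_LRcontinuous => // u; exact: dpow.
- move=> u uab; rewrite powR_derive1// in_itv/= andbT.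
  by apply: pos; exact: subset_itv_oo_cc uab.
- by apply: derivable_within_continuous => u _.
- by apply: derivable_segment_LRcontinuous => // u _; apply: ex_derive.
- by move=> u _; rewrite derive1E derive_val.
Qed.

(** Monotone convergence in the extended reals, so that the limit is meaningful
before anything is known about the integrability of [f]. *)
Lemma cvg_integral_half_line (f : R -> R) :
  (forall u, 0 <= f u) -> measurable_fun setT (EFin \o f) ->
  (\int[mu]_(u in `[(n.+2%:R^-1 : R)%R, (n.+2%:R : R)%R]) (f u)%:E)%E
    @[n --> \oo] --> (\int[mu]_(u in `]0%R, +oo[) (f u)%:E)%E.
Proof.
move=> f0 mf.
have -> : `]0%R, +oo[%classic = \bigcup_n `[n.+2%:R^-1, n.+2%:R : R]%classic.
  apply/seteqP; split => u /=; rewrite in_itv/= andbT.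
    move=> u0; exists (Num.truncn u + Num.truncn u^-1)%N => //=.
    rewrite in_itv/= invf_ple ?posrE//; apply/andP; split.
      apply/ltW; rewrite (lt_le_trans (truncnS_gt _))// ler_nat.
      by rewrite !ltnS leqW// leq_addl.
    apply/ltW; rewrite (lt_le_trans (truncnS_gt _))// ler_nat.
    by rewrite !ltnS leqW// leq_addr.
  by move=> [n _] /=; rewrite in_itv/= => /andP[+ _]; apply: lt_le_trans.
apply: ge0_nondecreasing_set_cvg_integral => //.
- move=> m n mn; apply/subsetPset => u /=; rewrite !in_itv/= => /andP[lu ul].
  apply/andP; split.
    by apply: le_trans lu; rewrite lef_pV2 ?posrE// ler_nat.
  by apply: le_trans ul _; rewrite ler_nat.
- by move=> n; apply: measurable_funTS.
- by move=> n u _; rewrite lee_fin.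
Qed.

Lemma cvg_powR_harmonic x : 0 < x ->
  (n.+2%:R^-1 : R) `^ x @[n --> \oo] --> (0 : R).
Proof.
move=> x0; apply: ((cvg_at_rightP (@powR R ^~ x) 0 0).1 (powR_cvg0 x0)).
split=> [n|]; first by rewrite invr_gt0.
by have := @cvg_harmonic R; rewrite -[X in X -> _]cvg_shiftS.
Qed.

Lemma gamma_kernel_inv_cvg0 x : 0 < x ->
  gamma_kernel (x + 1) n.+2%:R^-1 @[n --> \oo] --> 0.
Proof.
move=> x0; apply: squeeze_cvgr (cvg_cst 0) (cvg_powR_harmonic x0).
apply: nearW => n; rewrite gamma_kernel_ge0/= /gamma_kernel addrK.
by rewrite ler_piMr ?powR_ge0// -expR0 ler_expR oppr_le0.
Qed.

Lemma gamma_kernel_cvg0 x : 0 < x ->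
  gamma_kernel (x + 1) n.+2%:R @[n --> \oo] --> 0.
Proof.
move=> x0; pose c := 2 * x ^+ 2.
have c0 : 0 <= c by rewrite mulr_ge0// sqr_ge0.
have le_kernel n : gamma_kernel (x + 1) n.+2%:R <= c `^ x * n.+2%:R^-1 `^ x.
  rewrite -powRM// /gamma_kernel addrK.
  set u : R := n.+2%:R; have u0 : 0 < u by rewrite ltr0n.
  (* Taking [expR (- u)] as an [x]-th power reduces the bound to
     [u * expR (- (u / x)) <= c / u], which follows from
     [1 + v ^+ 2 / 2 <= expR v] at [v = u / x]. *)
  have -> : expR (- u) = expR (- (u / x)) `^ x.
    by rewrite -expRM; congr expR; field; rewrite gt_eqF.
  rewrite -powRM ?expR_ge0 ?(ltW u0)//.
  apply: ge0_ler_powR;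
    rewrite ?nnegrE ?mulr_ge0 ?expR_ge0 ?invr_ge0 ?(ltW u0) ?(ltW x0)//.
  have v0 : 0 <= u / x by rewrite divr_ge0 ?(ltW u0) ?(ltW x0).
  rewrite expRN ler_pdivrMr ?expR_gt0// mulrAC ler_pdivlMr//.
  have -> : u * u = c * ((u / x) ^+ 2 / 2) by rewrite /c; field; rewrite gt_eqF.
  apply: ler_wpM2l => //; apply: le_trans (expR_ge1Dxn 1 v0).
  by rewrite lerDr.
apply: (@squeeze_cvgr _ _ _ _ (fun=> 0) (fun n => c `^ x * n.+2%:R^-1 `^ x)).
- by apply: nearW => n; rewrite gamma_kernel_ge0 le_kernel.
- exact: cvg_cst.
rewrite -[X in _ --> X](mulr0 (c `^ x)).
by apply: cvgM; [exact: cvg_cst|exact: cvg_powR_harmonic].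
Qed.

(** On each segment, integration by parts gives this relation up to the boundary
terms [gamma_kernel (x + 1)] at the two ends, which tend to [0].  The limit is
taken in the extended reals, and [fine] commutes with multiplication by a
positive real even at infinity. *)
Lemma Gamma_intD1 x : 0 < x -> Gamma_int (x + 1) = x * Gamma_int x.
Proof.
move=> x0.
have EG : (\int[mu]_(u in `]0%R, +oo[) (gamma_kernel (x + 1) u)%:E =
   x%:E * \int[mu]_(u in `]0%R, +oo[) (gamma_kernel x u)%:E)%E.
  have cvgI z := @cvg_integral_half_line (gamma_kernel z)
    (gamma_kernel_ge0 z) (@measurable_gamma_kernel z setT).
  apply: (cvg_unique _ (cvgI (x + 1))) => //.
  have -> : (fun n => \int[mu]_(u in `[(n.+2%:R^-1 : R)%R, (n.+2%:R : R)%R])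
      (gamma_kernel (x + 1) u)%:E)%E = (fun n =>
      (gamma_kernel (x + 1) n.+2%:R^-1 - gamma_kernel (x + 1) n.+2%:R)%:E +
      x%:E * \int[mu]_(u in `[(n.+2%:R^-1 : R)%R, (n.+2%:R : R)%R])
        (gamma_kernel x u)%:E)%E.
    apply/funext => n; apply: gamma_kernel_by_parts; rewrite ?invr_gt0//.
    by rewrite (@lt_trans _ _ 1) ?invf_lt1 ?ltr1n.
  rewrite -(add0e (x%:E * _)%E); apply: cvgeD; last first.
    by apply: cvgeZl => //; exact: cvgI.
  - apply: cvg_EFin; first exact: nearW.
    rewrite -(subr0 0); apply: cvgB.
      exact: gamma_kernel_inv_cvg0.
    exact: gamma_kernel_cvg0.
  - by rewrite fin_num_adde_defr.
have fineMl (e : \bar R) : fine (x%:E * e)%E = x * fine e.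
  by case: e => [r//| |]; rewrite mulr_infty gtr0_sg// mul1e mulr0.
exact: etrans (congr1 fine EG) (fineMl _).
Qed.

Lemma Gamma_int_ge0 x : 0 <= Gamma_int x.
Proof. by apply: Rintegral_ge0 => u _; exact: gamma_kernel_ge0. Qed.

Lemma Gamma_pos x : 0 < x -> Gamma x = Gamma_int x.
Proof.
move=> x0; rewrite /Gamma.
have -> : Num.truncn (1 - x) = 0%N.
  by apply/truncn0Pn; rewrite -ltNge; lra.
by rewrite addr0 big_ord0 divr1.
Qed.

Lemma Gamma_ge0 x : 0 < x -> 0 <= Gamma x.
Proof. by move=> x0; rewrite Gamma_pos// Gamma_int_ge0. Qed.

(** * Weights of the fractional difference *)

Definition gamma_ratio (p : R) (m : nat) : R :=
  Gamma (m%:R + p) / Gamma (m%:R + 1).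

Lemma gamma_ratio_ge0 (p : R) m : 0 < p -> 0 <= gamma_ratio p m.
Proof. by move=> p0; rewrite divr_ge0 ?Gamma_ge0 ?ltr_wpDl. Qed.

Lemma gamma_ratio_nonincreasing (p : R) m : 0 < p <= 1 ->
  gamma_ratio p m.+1 <= gamma_ratio p m.
Proof.
move=> /andP[p0 p1].
have mp0 : 0 < m%:R + p by rewrite ltr_wpDl.
have m10 : 0 < m%:R + 1 :> R by rewrite ltr_wpDl.
have -> : gamma_ratio p m.+1 = (m%:R + p) / (m%:R + 1) * gamma_ratio p m.
  rewrite /gamma_ratio -(natr1 m) [_ + 1 + p]addrAC.
  rewrite !Gamma_pos ?(addr_gt0 mp0) ?(addr_gt0 m10)//.
  by rewrite (Gamma_intD1 mp0) (Gamma_intD1 m10) invfM; ring.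
apply: ler_piMl; first exact: gamma_ratio_ge0.
rewrite ler_pdivrMr ?ltr_wpDl//.
by rewrite mul1r lerD2l.
Qed.

End gamma.

(** With [m = k - j] and [p = 1 - nu], the first argument is the (possibly
negative) distance from [x_(j+1)], the image of [x_j] by [sigma], to [t]. *)
Lemma hfact_gamma_ratio (R : realType) (h p : R) m : 0 < h ->
  hfact h ((m%:R + p - 1) * h) (p - 1) = h `^ (p - 1) * gamma_ratio p m.
Proof.
move=> h0; rewrite /hfact /gamma_ratio mulfK ?gt_eqF// subrK.
by congr (_ * (_ / Gamma _)); ring.
Qed.

(** The form in which the operator enters the proof: a weighted sum of increments
whose weights do not depend on the function, hence are shared by the scalar
function [Q \o y] and by all the coordinates of [y].  For [nu = 1] the operator
is the plain difference quotient, and only the last weight is nonzero. *)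
Lemma caputo_weights (R : realType) (h a nu : R) (k : nat) :
  0 < h -> 0 < nu -> nu <= 1 ->
  exists c : nat -> R, [/\ forall j, 0 <= c j,
    forall j, (j < k)%N -> c j <= c j.+1 &
    forall f : R -> R, caputo h a nu f (a + (1 - nu) * h + k%:R * h) =
      \sum_(0 <= j < k.+1) c j * (f (a + j.+1%:R * h) - f (a + j%:R * h))].
Proof.
move=> h0 nu0; rewrite le_eqVlt => /orP[/eqP->|nu1].
  exists (fun j => (j == k)%:R / h); split.
  - by move=> j; rewrite divr_ge0 ?(ltW h0).
  - move=> j jk; rewrite (ltn_eqF jk) mul0r divr_ge0 ?(ltW h0)//.
  - move=> f; rewrite /caputo /hsum subrr eqxx mul0r addr0 /hdiff.
    rewrite big_nat_recr//= big_nat big1 ?add0r => [|j /andP[_ jk]].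
      rewrite eqxx -(natr1 k) [(_ + 1) * h]mulrDl mul1r addrA.
      by rewrite mulr1n mul1r mulrC.
    by rewrite (ltn_eqF jk) !mul0r.
have p0 : 0 < 1 - nu by rewrite subr_gt0.
have p1 : 0 < 1 - nu <= 1 by rewrite p0/= gerBl ltW.
exists (fun j => (Gamma (1 - nu))^-1 *
  (h `^ (1 - nu - 1) * gamma_ratio (1 - nu) (k - j))); split.
- move=> j; apply: mulr_ge0; first by rewrite invr_ge0 Gamma_ge0.
  by apply: mulr_ge0; [exact: powR_ge0|exact: gamma_ratio_ge0].
- move=> j jk; apply: ler_wpM2l; first by rewrite invr_ge0 Gamma_ge0.
  apply: ler_wpM2l; first exact: powR_ge0.
  rewrite subnS -{1}(prednK (n := k - j)) ?subn_gt0//.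
  exact: gamma_ratio_nonincreasing.
- move=> f; rewrite /caputo /hsum gt_eqF//.
  have -> : (a + (1 - nu) * h + k%:R * h) / h - (1 - nu) - a / h = k%:R.
    by field; rewrite gt_eqF.
  rewrite natrK mulr_sumr; apply: eq_big_nat => j; rewrite ltnS => /andP[_ jk].
  rewrite /sigma.
  have -> : a + (1 - nu) * h + k%:R * h - ((a / h + j%:R) * h + h) =
      ((k - j)%:R + (1 - nu) - 1) * h.
    by rewrite natrB//; field; rewrite gt_eqF.
  have -> : (a / h + j%:R) * h = a + j%:R * h by field; rewrite gt_eqF.
  rewrite hfact_gamma_ratio// /hdiff -(natr1 j) [(_ + 1) * h]mulrDl mul1r addrA.
  by move: (Gamma _)^-1 => g; field; rewrite gt_eqF.
Qed.

(** * Summation by parts and the quadratic form *)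

(** Summation by parts leaves the boundary term on the right, a nonpositive term
at [0], and terms [- (c j.+1 - c j) * q j.+1], all nonpositive. *)
Lemma sum_by_parts_le (R : realDomainType) (c q : nat -> R) (k : nat) :
  (forall j, 0 <= q j) -> (forall j, 0 <= c j) ->
  (forall j, (j < k)%N -> c j <= c j.+1) ->
  \sum_(0 <= j < k.+1) c j * (q j.+1 - q j) <= c k * q k.+1.
Proof.
move=> q0 c0; elim: k => [|k IH] cS.
  by rewrite big_nat1 mulrBr gerBl mulr_ge0.
rewrite big_nat_recr//= mulrBr addrCA gerDl subr_le0.
apply: le_trans (IH _) _ => [j jk|]; first by rewrite cS// ltnW.
by rewrite ler_wpM2r// cS.
Qed.

Lemma posdefmx_ge0 (R : realType) (n : nat) (P : 'M[R]_n) (x : 'cV[R]_n) :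
  posdefmx P -> 0 <= (x^T *m P *m x) 0 0.
Proof.
move=> Ppos; have [->|x0] := eqVneq x 0; first by rewrite mulmx0 mxE.
exact/ltW/Ppos.
Qed.

Lemma quad_formB (R : realType) (n : nat) (P : 'M[R]_n) (z u : 'cV[R]_n) :
  P^T = P ->
  ((u - z)^T *m P *m (u - z)) 0 0 =
  (u^T *m P *m u) 0 0 - (z^T *m P *m u) 0 0 *+ 2 + (z^T *m P *m z) 0 0.
Proof.
move=> Psym; have -> : (z^T *m P *m u) 0 0 *+ 2 =
    (z^T *m P *m u) 0 0 + (u^T *m P *m z) 0 0.
  rewrite mulr2n; congr (_ + _).
  by rewrite -[u^T *m P *m z]trmxK [in RHS]mxE !trmx_mul trmxK Psym mulmxA.
rewrite [(u - z)^T]linearB/= !(mulmxBl, mulmxBr) !mxE; ring.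
Qed.

Theorem proposition3p11 (R : realType) (n : nat) (h a nu : R)
    (y : R -> 'cV[R]_n) (P : 'M[R]_n)
    (h_gt0 : 0 < h) (nu_gt0 : 0 < nu) (nu_le1 : nu <= 1)
    (P_sym : P^T = P) (P_posdef : posdefmx P)
    (t : R) (t_grid : hgrid h (a + (1 - nu) * h) t) :
  2^-1 * caputo h a nu (fun u => ((y u)^T *m P *m y u) 0 0) t
    <= ((y (t + nu * h))^T *m P *m caputo_vec h a nu y t) 0 0.
Proof.
have [k ->] := t_grid.
have [c [c0 cS cE]] := caputo_weights a k h_gt0 nu_gt0 nu_le1.
pose x j := y (a + j%:R * h).
have -> : y (a + (1 - nu) * h + k%:R * h + nu * h) = x k.+1.
  by rewrite /x -natr1; congr y; ring.
have -> : caputo_vec h a nu y (a + (1 - nu) * h + k%:R * h) =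
    \sum_(0 <= j < k.+1) c j *: (x j.+1 - x j).
  apply/matrixP => i o; rewrite ord1 mxE cE summxE.
  by apply: eq_bigr => j _; rewrite !mxE.
pose q j := 2^-1 * ((x j - x k.+1)^T *m P *m (x j - x k.+1)) 0 0.
rewrite cE mulmx_sumr summxE mulr_sumr -subr_le0 -sumrB.
rewrite (eq_bigr (fun j => c j * (q j.+1 - q j))); last first.
  move=> j _; rewrite /q !quad_formB// -scalemxAr mulmxBr !mxE.
  by rewrite -!/(x _); field.
apply: le_trans (sum_by_parts_le _ c0 cS) _.
  by move=> j; rewrite mulr_ge0// posdefmx_ge0.
by rewrite /q subrr mulmx0 mxE !mulr0.
Qed.
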